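(* Over $\mathsf{S4}\otimes\mathsf{S4}\otimes\mathsf{S4}$, the axioms $(\mathsf{sub})=\Box p\to\Box_1p\land\Box_2p$ and $(\mathsf{mix})=\Box p\to\Box_1\Box_2p\land\Box_2\Box_1p$ are equivalent, that is, $$\mathsf{S4}\otimes\mathsf{S4}\otimes\mathsf{S4}+(\mathsf{sub})\;=\;\mathsf{S4}\otimes\mathsf{S4}\otimes\mathsf{S4}+(\mathsf{mix}).$$
   Context: Let $\mathsf{AP}$ be a set of atomic propositions; $p,q$ denote distinct elements of $\mathsf{AP}$. Formulas over a finite set of unary modal operators are built from $\bot$, atoms, $\neg,\land$ and the boxes; other Boolean connectives are the usual abbreviations. Uni-modal formulas use $\Box$; tri-modal formulas use $\Box_1,\Box_2,\Box$. A normal modal logic is a set of formulas containing all propositional tautologies and, for each box $\blacksquare$ of the language, the axiom $\blacksquare(p\to q)\to(\blacksquare p\to\blacksquare q)$, and closed under modus ponens, generalization ($\varphi/\blacksquare\varphi$ for each box) and uniform substitution. $\mathsf{K}$ is the smallest normal uni-modal logic. $\Lambda+\varphi_1+\dots+\varphi_k$ is the smallest normal logic (in the same language) containing $\Lambda$ and $\varphi_1,\dots,\varphi_k$. $\mathsf{S4}=\mathsf{K}+(\Box p\to p)+(\Box p\to\Box\Box p)$. The fusion $L_1\otimes L_2\otimes L_3$ of uni-modal logics is the smallest normal tri-modal logic over $\Box_1,\Box_2,\Box$ containing $L_1$ with $\Box$ renamed to $\Box_1$, $L_2$ with $\Box$ renamed to $\Box_2$, and $L_3$ (with $\Box$ kept).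 Two axioms are equivalent over a logic $L$ if each belongs to the smallest normal logic extending $L$ by the other. *)

(* Defs.v *)
From Stdlib Require List.
From mathcomp Require Import all_boot.
From mathcomp Require Import classical_sets.

Set Implicit Arguments.
Unset Strict Implicit.
Unset Printing Implicit Defensive.

Local Open Scope classical_set_scope.

(* [M] indexes the boxes of the language. *)
Inductive form (AP M : Type) : Type :=
| Bot
| Atom of AP
| Neg of form AP M
| And of form AP M & form AP M
| Box of M & form AP M.

Arguments Bot {AP M}.
Arguments Atom {AP M} _.

Definition Imp (AP M : Type) (A B : form AP M) : form AP M :=
  Neg (And A (Neg B)).

Fixpoint subst (AP M : Type) (s : AP -> form AP M) (A : form AP M) :
    form AP M :=
  match A with
  | Bot => Bot
  | Atom x => s x
  | Neg B => Neg (subst s B)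
  | And B C => And (subst s B) (subst s C)
  | Box m B => Box m (subst s B)
  end.

(* Truth-functional evaluation: boxed formulas are treated as additional
   propositional variables, so that e.g. [Imp (Box m A) (Box m A)] counts as a
   propositional tautology. This matters only when [AP] is finite: otherwise
   such formulas are substitution instances of box-free tautologies. *)
Fixpoint eval (AP M : Type) (a : AP -> bool) (b : M -> form AP M -> bool)
    (A : form AP M) : bool :=
  match A with
  | Bot => false
  | Atom x => a x
  | Neg B => ~~ eval a b B
  | And B C => eval a b B && eval a b C
  | Box m B => b m B
  end.

Definition tautology (AP M : Type) (A : form AP M) : Prop :=
  forall (a : AP -> bool) (b : M -> form AP M -> bool), eval a b A.

(* [p] and [q] are the two distinguished atoms in which axioms are written;
   they have to be distinct for [normal_K] to be the usual axiom. *)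
Record normal (AP M : Type) (p q : AP) (L : set (form AP M)) : Prop := {
  normal_taut : forall A, tautology A -> L A ;
  normal_K : forall m,
    L (Imp (Box m (Imp (Atom p) (Atom q)))
           (Imp (Box m (Atom p)) (Box m (Atom q)))) ;
  normal_mp : forall A B, L (Imp A B) -> L A -> L B ;
  normal_gen : forall m A, L A -> L (Box m A) ;
  normal_subst : forall s A, L A -> L (subst s A)
}.

(* [smallest C G] is the intersection of all sets satisfying [C] and including
   [G]; the lemma shows that, for [C := normal p q], it is itself normal. *)
Lemma normal_smallest (AP M : Type) (p q : AP) (G : set (form AP M)) :
  normal p q (smallest (normal p q) G).
Proof.
split.
- by move=> A tA L [nL _]; apply: (normal_taut nL).
- by move=> m L [nL _]; apply: (normal_K nL).
- move=> A B hAB hA L hL; have [nL _] := hL.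
  by apply: (normal_mp nL (hAB L hL) (hA L hL)).
- by move=> m A hA L hL; have [nL _] := hL; apply: (normal_gen nL); apply: hA.
- by move=> s A hA L hL; have [nL _] := hL; apply: (normal_subst nL); apply: hA.
Qed.

(* L + A_1 + ... + A_k *)
Definition extend (AP M : Type) (p q : AP) (L : set (form AP M))
    (As : seq (form AP M)) : set (form AP M) :=
  smallest (normal p q) (L `|` [set A | List.In A As]).

Definition equivalent_over (AP M : Type) (p q : AP) (L : set (form AP M))
    (A B : form AP M) : Prop :=
  extend p q L [:: A] B /\ extend p q L [:: B] A.

Definition uni_box := unit.

Definition logicK (AP : Type) (p q : AP) : set (form AP uni_box) :=
  smallest (normal p q) set0.

Definition axT (AP : Type) (p : AP) : form AP uni_box :=
  Imp (Box tt (Atom p)) (Atom p).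

Definition ax4 (AP : Type) (p : AP) : form AP uni_box :=
  Imp (Box tt (Atom p)) (Box tt (Box tt (Atom p))).

Definition logicS4 (AP : Type) (p q : AP) : set (form AP uni_box) :=
  extend p q (logicK p q) [:: axT p; ax4 p].

(* [box1], [box2] and [box0] stand for the boxes with subscript 1, with
   subscript 2 and without subscript. *)
Inductive tri_box : Type := box1 | box2 | box0.

Fixpoint rename (AP M N : Type) (f : M -> N) (A : form AP M) : form AP N :=
  match A with
  | Bot => Bot
  | Atom x => Atom x
  | Neg B => Neg (rename f B)
  | And B C => And (rename f B) (rename f C)
  | Box m B => Box (f m) (rename f B)
  end.

Definition fusion3 (AP : Type) (p q : AP) (L1 L2 L3 : set (form AP uni_box)) :
    set (form AP tri_box) :=
  smallest (normal p q)
    (rename (fun=> box1) @` L1 `|` rename (fun=> box2) @` L2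
      `|` rename (fun=> box0) @` L3).

Definition ax_sub (AP : Type) (p : AP) : form AP tri_box :=
  Imp (Box box0 (Atom p)) (And (Box box1 (Atom p)) (Box box2 (Atom p))).

Definition ax_mix (AP : Type) (p : AP) : form AP tri_box :=
  Imp (Box box0 (Atom p))
      (And (Box box1 (Box box2 (Atom p))) (Box box2 (Box box1 (Atom p)))).

Definition S4S4S4 (AP : Type) (p q : AP) : set (form AP tri_box) :=
  fusion3 p q (logicS4 p q) (logicS4 p q) (logicS4 p q).

(* Main.v *)
Require Import Defs.
From mathcomp Require Import all_boot.
From mathcomp Require Import boolp classical_sets.

Set Implicit Arguments.
Unset Strict Implicit.
Unset Printing Implicit Defensive.

(** From (sub) to (mix): [Box p] implies [Box Box p], hence [Box Box2 p] by
    monotonicity, hence [Box1 Box2 p] by (sub) at [Box2 p]. From (mix) to (sub):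
    [Box p] implies [Box1 Box2 p], hence [Box1 p] because [Box2 p] implies [p].
    Exchanging the indices 1 and 2 yields the other conjuncts. *)

Section NormalLogic.
Variables (AP M : Type) (p q : AP) (L : set (form AP M)).
Hypothesis nL : normal p q L.

Lemma normal_imp_trans A B C : L (Imp A B) -> L (Imp B C) -> L (Imp A C).
Proof.
move=> hAB hBC; apply: (normal_mp nL _ hBC); apply: (normal_mp nL _ hAB).
by apply: (normal_taut nL) => a b /=; do 3!case: (eval _ _ _).
Qed.

Lemma normal_imp_andl A B C : L (Imp A (And B C)) -> L (Imp A B).
Proof.
move=> h; apply: (normal_imp_trans h).
by apply: (normal_taut nL) => a b /=; do 2!case: (eval _ _ _).
Qed.

Lemma normal_imp_andr A B C : L (Imp A (And B C)) -> L (Imp A C).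
Proof.
move=> h; apply: (normal_imp_trans h).
by apply: (normal_taut nL) => a b /=; do 2!case: (eval _ _ _).
Qed.

Lemma normal_imp_and A B C :
  L (Imp A B) -> L (Imp A C) -> L (Imp A (And B C)).
Proof.
move=> hB hC; apply: (normal_mp nL _ hC); apply: (normal_mp nL _ hB).
by apply: (normal_taut nL) => a b /=; do 3!case: (eval _ _ _).
Qed.

(** Generalization boxes the implication; the instance of the K axiom with [A] for [p] and [B] for
    [q] then distributes the box. *)
Lemma normal_box_mono (hpq : p <> q) m A B :
  L (Imp A B) -> L (Imp (Box m A) (Box m B)).
Proof.
move=> hAB; apply: (normal_mp nL _ (normal_gen nL m hAB)).
(* The substitution sends [p] to [A] and every other atom, in particular [q], to [B]. Equality on
   [AP] is decided classically, and [hpq] ensures that [q] takes the second branch. *)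
have := normal_subst nL (fun x => if `[< x = p >] then A else B)
  (normal_K nL m).
by rewrite /= asboolT // asboolF // => /esym.
Qed.

End NormalLogic.

Lemma extend_sub (AP M : Type) (p q : AP) (L : set (form AP M)) As :
  (L `<=` extend p q L As)%classic.
Proof. by move=> A LA L' [_]; apply; left. Qed.

Lemma extend_axiom (AP M : Type) (p q : AP) (L : set (form AP M)) As A :
  List.In A As -> extend p q L As A.
Proof. by move=> hA L' [_]; apply; right. Qed.

(** By minimality, an extension of [L] that contains the other axiom includes the other extension;
    both inclusions arise this way. *)
Lemma equivalent_over_extend (AP M : Type) (p q : AP) (L : set (form AP M))
    A B :
  equivalent_over p q L A B -> extend p q L [:: A] = extend p q L [:: B].
Proof.
have sub C D : extend p q L [:: C] D ->
    (extend p q L [:: D] `<=` extend p q L [:: C])%classic.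
  move=> hD; apply: smallest_sub; first exact: normal_smallest.
  by move=> E [LE|[<-//|[]]]; apply: extend_sub.
by move=> [hB hA]; apply/seteqP; split; apply: sub.
Qed.

Lemma S4S4S4_rename (AP : Type) (p q : AP) (m : tri_box) A :
  logicS4 p q A -> S4S4S4 p q (rename (fun=> m) A).
Proof.
move=> hA L [_]; apply.
by case: m; [left; left | left; right | right]; exists A.
Qed.

Section AboveS4S4S4.
Variables (AP : Type) (p q : AP) (L : set (form AP tri_box)).
Hypotheses (hpq : p <> q) (nL : normal p q L).
Hypothesis S4L : (S4S4S4 p q `<=` L)%classic.

Lemma above_S4S4S4_T m : L (Imp (Box m (Atom p)) (Atom p)).
Proof.
apply: S4L; apply: (@S4S4S4_rename _ p q m (axT p)).
by apply: extend_axiom; left.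
Qed.

Lemma above_S4S4S4_4 m : L (Imp (Box m (Atom p)) (Box m (Box m (Atom p)))).
Proof.
apply: S4L; apply: (@S4S4S4_rename _ p q m (ax4 p)).
by apply: extend_axiom; right; left.
Qed.

(** [L] is an arbitrary normal logic above the fusion, to be instantiated with the extension by
    (sub). *)
Lemma above_S4S4S4_mix : L (ax_sub p) -> L (ax_mix p).
Proof.
move=> hsub.
have sub1 := normal_imp_andl nL hsub; have sub2 := normal_imp_andr nL hsub.
have mix m n : L (Imp (Box box0 (Atom p)) (Box m (Atom p))) ->
    L (Imp (Box box0 (Atom p)) (Box n (Atom p))) ->
    L (Imp (Box box0 (Atom p)) (Box m (Box n (Atom p)))).
  move=> hm hn; apply: (normal_imp_trans nL (above_S4S4S4_4 box0)).
  apply: (normal_imp_trans nL (normal_box_mono nL hpq box0 hn)).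
  (* A constant substitution suffices, since [p] is the only atom in [hm]. *)
  exact: (normal_subst nL (fun=> Box n (Atom p)) hm).
by apply: (normal_imp_and nL); apply: mix.
Qed.

Lemma above_S4S4S4_sub : L (ax_mix p) -> L (ax_sub p).
Proof.
move=> hmix; apply: (normal_imp_and nL).
- apply: (normal_imp_trans nL (normal_imp_andl nL hmix)).
  exact: (normal_box_mono nL hpq _ (above_S4S4S4_T _)).
- apply: (normal_imp_trans nL (normal_imp_andr nL hmix)).
  exact: (normal_box_mono nL hpq _ (above_S4S4S4_T _)).
Qed.

End AboveS4S4S4.

Theorem proposition1p3 (AP : Type) (p q : AP) (hpq : p <> q) :
  equivalent_over p q (S4S4S4 p q) (ax_sub p) (ax_mix p) /\
  extend p q (S4S4S4 p q) [:: ax_sub p] = extend p q (S4S4S4 p q) [:: ax_mix p].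
Proof.
have equiv : equivalent_over p q (S4S4S4 p q) (ax_sub p) (ax_mix p).
  split.
  - apply: (above_S4S4S4_mix hpq (normal_smallest _ _ _)).
      exact: extend_sub.
    by apply: extend_axiom; left.
  - apply: (above_S4S4S4_sub hpq (normal_smallest _ _ _)).
      exact: extend_sub.
    by apply: extend_axiom; left.
by split=> //; apply: equivalent_over_extend.
Qed.
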